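(* Let $\mathcal{P}$ be a set of $n$ points in $\mathbb{R}^d$ and let $V\subset\mathbb{R}^d$ be an irreducible real algebraic variety of degree $D$ and dimension $d'\ge 1$. Then for every $1<r\le n$ there exists an $r$-partitioning polynomial $g$ for $\mathcal{P}$ such that $g\notin I(V)$ and $\deg g\le C\, r^{1/d'}$, where $C$ depends only on $d$ and $D$.
   Context: A real variety $V\subset\mathbb{R}^d$ is irreducible if it is irreducible over $\mathbb{R}$; its dimension is its real (semi-algebraic) dimension; its degree is the degree of its complexification $V^*$ (the Zariski closure of $V$ in $\mathbb{C}^d$). $I(V)$ is the ideal of polynomials in $\mathbb{R}[x_1,\dots,x_d]$ vanishing on $V$. For $Z(g)=\{x\in\mathbb{R}^d: g(x)=0\}$, a polynomial $g\in\mathbb{R}[x_1,\dots,x_d]$ is an $r$-partitioning polynomial for an $n$-point set $\mathcal{P}$ if no connected component of $\mathbb{R}^d\setminus Z(g)$ contains more than $n/r$ points of $\mathcal{P}$ (no restriction on points in $Z(g)$). *)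

(* Defs.v *)
From HB Require Import structures.
From mathcomp Require Import all_boot all_order all_algebra.
From mathcomp Require Import mpoly. (* imported BEFORE analysis to avoid notation clash *)
From mathcomp Require Import all_classical all_reals all_analysis.
From mathcomp Require complex.
Import complex.ComplexField.
Import numFieldNormedType.Exports.

Set Implicit Arguments.
Unset Strict Implicit.
Unset Printing Implicit Defensive.
Import Order.TTheory GRing.Theory Num.Theory.
Local Open Scope classical_set_scope.
Local Open Scope ring_scope.

Definition peval (K : comNzRingType) (d : nat) (p : mpoly.mpoly d K) (x : 'rV[K]_d) : K :=
  mpoly.meval (fun i => x ord0 i) p.

(** total degree of a polynomial (deg 0 := 0) *)
Definition pdeg (K : nzRingType) (d : nat) (p : mpoly.mpoly d K) : nat :=
  (\max_(m <- mpoly.msupp p) mpoly.mdeg m)%N.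

Definition zero_set (K : comNzRingType) (d : nat) (g : mpoly.mpoly d K) : set 'rV[K]_d :=
  [set x | peval g x = 0].

Definition algebraic_variety (K : comNzRingType) (d : nat) (V : set 'rV[K]_d) : Prop :=
  exists S : seq (mpoly.mpoly d K),
    V = [set x | forall p, p \in S -> peval p x = 0].

Definition vanishing_ideal (K : comNzRingType) (d : nat) (V : set 'rV[K]_d)
  : set (mpoly.mpoly d K) :=
  [set p | forall x, V x -> peval p x = 0].

Definition irreducible_variety (K : comNzRingType) (d : nat) (V : set 'rV[K]_d) : Prop :=
  V !=set0 /\
  forall V1 V2 : set 'rV[K]_d, algebraic_variety V1 -> algebraic_variety V2 ->
    V = V1 `|` V2 -> V = V1 \/ V = V2.

Definition is_ideal (A : comNzRingType) (I : set A) : Prop :=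
  I 0 /\ (forall a b, I a -> I b -> I (a + b)) /\ (forall a b, I b -> I (a * b)).

Definition is_prime_ideal (A : comNzRingType) (I : set A) : Prop :=
  is_ideal I /\ ~ I 1 /\ (forall a b, I (a * b) -> I a \/ I b).

Definition prime_chain_above (A : comNzRingType) (J : set A) (k : nat) : Prop :=
  exists P : nat -> set A,
    (forall i, (i <= k)%N -> is_prime_ideal (P i)) /\
    J `<=` P 0%N /\
    (forall i, (i < k)%N -> P i `<` P i.+1).

Definition krull_dim_quot (A : comNzRingType) (J : set A) (k : nat) : Prop :=
  prime_chain_above J k /\ ~ prime_chain_above J k.+1.

(** dimension of a variety V in K^d: Krull dimension of K[x]/I(V)
    (for K real closed this is the semi-algebraic dimension, BCR Def. 2.8.1) *)
Definition variety_dim (K : comNzRingType) (d : nat) (V : set 'rV[K]_d) (k : nat) : Prop :=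
  krull_dim_quot (vanishing_ideal V) k.

Definition realC (R : rcfType) (d : nat) (x : 'rV[R]_d) : 'rV[complex.complex R]_d :=
  map_mx (fun a => complex.real_complex R a) x.

Definition complexification (R : rcfType) (d : nat) (V : set 'rV[R]_d)
  : set 'rV[complex.complex R]_d :=
  [set z | forall q : mpoly.mpoly d (complex.complex R),
     (forall x, V x -> peval q (realC x) = 0) -> peval q z = 0].

Definition affine_subspace (K : fieldType) (d m : nat) (L : set 'rV[K]_d) : Prop :=
  exists (a : 'rV[K]_d) (M : 'M[K]_(m, d)),
    \rank M = m /\ L = [set x | exists t : 'rV[K]_m, x = a + t *m M].

Definition has_card (T : eqType) (A : set T) (n : nat) : Prop :=
  exists s : seq T, uniq s /\ size s = n /\ (forall x, A x <-> x \in s).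

(** degree of an (irreducible) variety W in K^d of dimension k (Heintz):
    the maximum number of points of W /\ L, over affine subspaces L of
    dimension d - k with W /\ L finite *)
Definition variety_degree (K : fieldType) (d : nat) (W : set 'rV[K]_d) (D : nat) : Prop :=
  exists k : nat, variety_dim W k /\
    (exists L, affine_subspace (d - k) L /\ has_card (W `&` L) D) /\
    (forall L n, affine_subspace (d - k) L -> has_card (W `&` L) n -> (n <= D)%N).

Definition partitioning_poly (R : realType) (d : nat) (P : seq 'rV[R]_d) (r : R)
  (g : mpoly.mpoly d R) : Prop :=
  forall x, ~ zero_set g x ->
    (count (fun p => p \in connected_component (~` zero_set g) x) P)%:R
      <= (size P)%:R / r.

(* Main.v *)
(** A chain of k primes above I(V) yields k coordinates that are algebraically
    independent modulo I(V): along a strict inclusion P < Q of primes, if every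
    coordinate were algebraic modulo P over coordinates independent modulo Q,
    then so would be any f in Q \ P, and the constant term of its minimal
    relation would be a nonzero polynomial in Q. So it suffices to partition the
    projections of the points to R^k by a nonzero polynomial in these k
    coordinates, by iterated polynomial ham-sandwich cuts: at step j the space of
    polynomials with exponents below 2^(floor(j/k)+1) has dimension more than
    2^j, and the degrees add up to O(r^(1/k)).

    For the ham-sandwich cut, let s_1, ..., s_m be odd
    sign functions on R^(m+1) \ 0 and c_0, c_1, ..., c_m chains mod 2 on the
    iterated barycentric subdivision of the octahedral sphere, with boundary
    c_(i+1) = c_i + (-c_i). The cup product of the coboundaries of s_1, ..., s_i
    is the coboundary of an explicit cochain, so its value on c_i does not
    depend on i; hence some small simplex of c_m has all s_i changing on it. A
    limit point of these simplices is the wanted hyperplane. *)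
Require Import Defs.
From HB Require Import structures.
From mathcomp Require Import all_boot all_order all_algebra.
From mathcomp Require Import mpoly.
From mathcomp Require Import all_classical all_reals all_analysis.
From mathcomp Require complex.
From mathcomp Require Import ring lra zify.
Import complex.ComplexField.
Import numFieldNormedType.Exports.
Import Order.TTheory GRing.Theory Num.Theory.
Set Implicit Arguments.
Unset Strict Implicit.
Unset Printing Implicit Defensive.
Local Open Scope classical_set_scope.
Local Open Scope quotient_scope.
Local Open Scope ring_scope.

(** * Algebraically independent coordinates from a chain of primes *)

(** The proofs are parameters so that the predicate itself carries the structure of a proper ideal,
    from which the quotient ring is built. *)
Definition proper_ideal_mem (A : comNzRingType) (I : set A)
  (idI : is_ideal I) (I1 : ~ I 1) : {pred A} := fun x => `[< I x >].

Lemma proper_ideal_mem_closed (A : comNzRingType) (I : set A)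
  (idI : is_ideal I) (I1 : ~ I 1) : idealr_closed (proper_ideal_mem idI I1).
Proof.
case: (idI) => I0 [ID IM]; split.
- exact/asboolP.
- by apply/negP => /asboolP.
- by move=> a u v /asboolP Iu /asboolP Iv; apply/asboolP/ID => //; exact: IM.
Qed.

HB.instance Definition _ (A : comNzRingType) (I : set A)
  (idI : is_ideal I) (I1 : ~ I 1) :=
  isIdealr.Build A (proper_ideal_mem idI I1) (proper_ideal_mem_closed idI I1).

Lemma ideal_is_kernel (A : comNzRingType) (I : set A) :
  is_ideal I -> ~ I 1 ->
  exists (B : comNzRingType) (f : {rmorphism A -> B}), forall x, f x = 0 <-> I x.
Proof.
move=> idI I1; pose J : idealr A := proper_ideal_mem idI I1.
pose B : comNzRingType := {ideal_quot J}.
exists B, (\pi_B : {rmorphism A -> B}) => x.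
have -> : (\pi_B x = 0 :> B) <-> (x - 0) \in J.
  rewrite Quotient.idealrBE; split => [h|/eqP h].
    by apply/eqP; rewrite [LHS]h raddf0.
  by rewrite [LHS]h raddf0.
by rewrite subr0; split => /asboolP.
Qed.

(** Treating the last variable separately turns a dependence among n+1 elements into a univariate
    relation for the last one. *)
Lemma comp_muni (R : comNzRingType) n k (lq : n.+1.-tuple {mpoly R[k]}) p :
  p \mPo lq =
  (map_poly (comp_mpoly [tuple tnth lq (widen_ord (leqnSn n) i) | i < n])
     (muni p)).[tnth lq ord_max].
Proof.
rewrite {1}[p]mpolyE muniE !raddf_sum /= horner_sum.
apply: eq_bigr => m _.
rewrite comp_mpolyZ comp_mpolyX map_polyZ /= map_polyXn hornerZ hornerXn.
rewrite comp_mpolyZ comp_mpolyX -scalerAl big_ord_recr /=; congr (_ *: (_ * _)).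
by apply: eq_bigr => i _; rewrite tnth_mktuple mnmE.
Qed.

Lemma muni_eq0 (R : comNzRingType) n (p : {mpoly R[n.+1]}) : muni p = 0 -> p = 0.
Proof.
by move=> p0; rewrite -[p]comp_mpoly_id comp_muni p0 raddf0 horner0.
Qed.

(** Multiplying a relation of degree N by [f c ^+ N.-1], with [c] the leading coefficient, makes it
    monic in [f c * x]. *)
Lemma horner_algebra_integral (A B : comNzRingType) (f : {rmorphism A -> B})
    (q : {poly A}) (x : B) : (1 < size q)%N -> (map_poly f q).[x] = 0 ->
  integralOver f (f (lead_coef q) * x).
Proof.
move=> q1 qx; set c := lead_coef q; pose N := (size q).-1.
have sq : size q = N.+1 by rewrite /N prednK // ltnW.
have N0 : (0 < N)%N by rewrite -ltnS -sq.
pose r : {poly A} := 'X^N + \poly_(i < N) (q`_i * c ^+ (N.-1 - i)).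
have sr : leq (size (\poly_(i < N) (q`_i * c ^+ (N.-1 - i)))).+1
              (size ('X^N : {poly A})).
  by rewrite size_polyXn ltnS size_poly.
exists r; first by rewrite monicE lead_coefDl // lead_coefXn.
rewrite /root /r rmorphD /= map_polyXn hornerD hornerXn.
have -> : (map_poly f (\poly_(i < N) (q`_i * c ^+ (N.-1 - i)))).[f c * x]
   = \sum_(i < N) f c ^+ N.-1 * (f q`_i * x ^+ i).
  rewrite poly_def rmorph_sum horner_sum; apply: eq_bigr => i _.
  rewrite /= map_polyZ /= map_polyXn hornerZ hornerXn rmorphM rmorphXn /= exprMn.
  have -> : f c ^+ N.-1 = f c ^+ (N.-1 - i) * f c ^+ i.
    by rewrite -exprD subnK // -ltnS prednK.
  by ring.
have qE : (map_poly f q).[x] = \sum_(i < N) f q`_i * x ^+ i + f c * x ^+ N.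
  rewrite (@horner_coef_wide _ N.+1) ?(leq_trans (size_poly _ _)) ?sq //.
  rewrite big_ord_recr /= coef_map /=; congr (_ + _).
  by apply: eq_bigr => i _; rewrite coef_map.
have -> : (f c * x) ^+ N = f c ^+ N.-1 * (f c * x ^+ N).
  by rewrite exprMn mulrA -exprSr prednK.
by rewrite -mulr_sumr -mulrDr addrC -qE qx mulr0.
Qed.

Section AlgebraicIndependence.
Variables (K : fieldType) (d : nat).

(** Composition with the projection to the coordinates [s], on the level of polynomials. *)
Definition pull n (s : 'I_n -> 'I_d) : {mpoly K[n]} -> {mpoly K[d]} :=
  comp_mpoly [tuple 'X_(s i) | i < n].

HB.instance Definition _ n (s : 'I_n -> 'I_d) := GRing.RMorphism.on (pull s).

Definition indep n (s : 'I_n -> 'I_d) (I : set {mpoly K[d]}) : Prop :=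
  forall p, I (pull s p) -> p = 0.

(* The constant term of a relation lies in Q together with h, so it vanishes;
   then h can be cancelled modulo P. *)
Lemma indep_no_relation n (s : 'I_n -> 'I_d) (P Q : set {mpoly K[d]}) h :
  is_prime_ideal P -> is_prime_ideal Q -> P `<=` Q -> indep s Q -> Q h -> ~ P h ->
  forall q : {poly {mpoly K[n]}}, P (map_poly (pull s) q).[h] -> q = 0.
Proof.
move=> [[_ [_ _]] [_ Pp]] [[Q0 [QD QM]] _] PQ sQ Qh Ph.
elim/poly_ind => // q a IH.
rewrite rmorphD rmorphM /= map_polyX map_polyC /= hornerMXaddC => Pqa.
have a0 : a = 0.
  apply: sQ; have -> : pull s a = (- (map_poly (pull s) q).[h]) * h +
     ((map_poly (pull s) q).[h] * h + pull s a) by ring.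
  by apply: QD; [exact: QM|exact: PQ].
move: Pqa; rewrite a0 rmorph0 addr0 => /Pp[/IH->|//].
by rewrite mul0r add0r.
Qed.

(** If no coordinate could be adjoined, all coordinates would be algebraic modulo [P] over those in
    [s], and a multiple h of some f in [Q] but not in [P] would be integral. Its monic relation
    contradicts [indep_no_relation]. *)
Lemma indep_extend n (s : 'I_n -> 'I_d) (P Q : set {mpoly K[d]}) :
  is_prime_ideal P -> is_prime_ideal Q -> P `<` Q -> indep s Q ->
  exists s' : 'I_n.+1 -> 'I_d, indep s' P.
Proof.
move=> pP pQ [PQ nQP] sQ; apply: contrapT => noext.
have [f Qf Pf] : exists2 f, Q f & ~ P f.
  by apply: contrapT => no; apply: nQP => f Qf; apply: contrapT => Pf; apply: no; exists f.
pose ext (j : 'I_d) (i : 'I_n.+1) := if unlift ord_max i is Some k then s k else j.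
have rel j : exists q : {poly {mpoly K[n]}}, q != 0 /\ P (map_poly (pull s) q).['X_j].
  have : ~ indep (ext j) P by move=> sP; apply: noext; exists (ext j).
  move=> /existsNP[p /not_implyP[Pp p0]]; exists (muni p); split.
    by apply/eqP => /muni_eq0.
  move: Pp; rewrite /pull comp_muni tnth_mktuple /ext unlift_none.
  set lq := [tuple tnth _ (widen_ord _ i) | i < n].
  suff -> : lq = [tuple 'X_(s i) | i < n] by [].
  apply: eq_from_tnth => i; rewrite !tnth_mktuple.
  case: unliftP => [k|] /(congr1 val) /=.
    by rewrite /bump leqNgt ltn_ord add0n => /val_inj ->.
  by move=> ik; have := ltn_ord i; rewrite ik ltnn.
have [q_ qP] := boolp.choice rel.
case: (pP) => idP [P1 Pp].
have [B [g gK]] := ideal_is_kernel idP P1.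
have [rho rhoE] : exists rho : {rmorphism {mpoly K[n]} -> B},
    forall u, rho u = g (pull s u) by exists (g \o pull s).
(* A common multiple of the leading coefficients, so that each [rho c * g 'X_j] is integral. *)
pose c := \prod_j lead_coef (q_ j).
have c0 : c != 0 by apply/prodf_neq0 => j _; rewrite lead_coef_eq0; exact: (qP j).1.
have rhoM (q : {poly {mpoly K[n]}}) h :
    (map_poly rho q).[g h] = g (map_poly (pull s) q).[h].
  rewrite -horner_map -map_poly_comp; congr (_.[_]).
  by apply: eq_map_poly => u; rewrite rhoE.
have intX j : integralOver rho (rho c * g 'X_j).
  rewrite /c (bigD1 j) //= rmorphM mulrAC; apply: integral_mul; last exact: integral_id.
  apply: horner_algebra_integral; last by rewrite rhoM; apply/gK; exact: (qP j).2.
  (* A constant relation would put a polynomial in the coordinates [s] into [P], hence into [Q], so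
     it would be zero. *)
  rewrite ltnNge; apply/negP => /size1_polyC qC.
  have [+ +] := qP j; rewrite qC map_polyC hornerC polyC_eq0 => /eqP q0 Pq.
  by apply/q0/sQ/PQ.
have [h [Qh Ph inth]] : exists h, [/\ Q h, ~ P h & integralOver rho (g h)].
  (* [msize f] exceeds the degree of every monomial of [f], so each variable in a monomial receives
     its own factor [c]. *)
  exists (pull s (c ^+ msize f) * f); split.
  - by case: pQ => -[_ [_ QM]] _; exact: QM.
  - move=> /Pp[] // /PQ /sQ /eqP; rewrite expf_eq0 (negbTE c0) andbF. by [].
  rewrite rmorphM -rhoE {2}[f]mpolyE rmorph_sum mulr_sumr.
  rewrite big_seq; apply: (big_ind (integralOver rho)).
  - exact: mxpoly.integral0.
  - by move=> x y; exact: integral_add.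
  move=> m /msize_mdeg_lt/ltnW mf.
  have -> : rho (c ^+ msize f) * g (f@_m *: 'X_[m]) =
      rho (c ^+ (msize f - mdeg m) * (f@_m)%:MP) * \prod_i (rho c * g 'X_i) ^+ m i.
    rewrite -mul_mpolyC mpolyXE_id !rmorphM /= rmorph_prod.
    under [in RHS]eq_bigr do rewrite exprMn.
    rewrite big_split /= prodrXr -mdegE -!rmorphXn /= -{1}(subnK mf) exprD !rmorphM /=.
    rewrite [rho (f@_m)%:MP]rhoE /pull comp_mpolyC.
    under [in LHS]eq_bigr do rewrite rmorphXn.
    exact: mulrACA.
  apply: integral_mul; first exact: integral_id.
  apply: (big_ind (integralOver rho)).
  - exact: mxpoly.integral1.
  - by move=> x y; exact: integral_mul.
  move=> i _; elim: (m i) => [|k IH]; first by rewrite expr0; exact: integral1.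
  by rewrite exprS; apply: integral_mul.
case: inth => q mq; rewrite /root rhoM => /eqP /gK Pq.
by have := indep_no_relation pP pQ PQ sQ Qh Ph Pq; apply/eqP/monic_neq0.
Qed.

(** Induction drops the bottom prime, and [indep_extend] gains one coordinate on returning to it.
    For k = 0, a nonzero constant is a unit and lies in no proper ideal. *)
Lemma prime_chain_indep k (J : set {mpoly K[d]}) : prime_chain_above J k ->
  exists s : 'I_k -> 'I_d, indep s J.
Proof.
move=> [P [pP [JP sP]]].
suff [s sP0] : exists s : 'I_k -> 'I_d, indep s (P 0%N).
  by exists s => p Jp; apply/sP0/JP.
elim: k P pP sP {J JP} => [|k IH] P pP sP.
  exists (fun i : 'I_0 => False_rect _ (notF (ltn_ord i))) => p Pp.
  have [[_ [_ PM]] [P1 _]] := pP 0%N (leqnn _).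
  apply: contrapT => /eqP p0; apply: P1.
  have pC : p = (p@_0)%:MP.
    apply: msize1_polyC; rewrite msizeE; apply/bigmax_leqP_seq => m _ _.
    by rewrite mdegE big_ord0.
  have u0 : p@_0 != 0 by apply: contraNneq p0 => u0; rewrite pC u0 mpolyC0.
  move: Pp; rewrite pC /pull comp_mpolyC => /(PM ((p@_0)^-1)%:MP).
  by rewrite -mpolyCM mulVf.
have [|i ik|s s1] := IH (fun i => P i.+1); first by move=> i ik; exact: pP.
  exact: sP.
by apply: (indep_extend (pP 0%N _) (pP 1%N _) (sP 0%N _) s1).
Qed.

(** This yields k <= d, so that the degree bound can be stated in terms of d. *)
Lemma indep_inj n (s : 'I_n -> 'I_d) (J : set {mpoly K[d]}) :
  J 0 -> indep s J -> injective s.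
Proof.
move=> J0 sJ i j sij; have /eqP : ('X_i - 'X_j : {mpoly K[n]}) = 0.
  by apply: sJ; rewrite rmorphB /= /pull !comp_mpolyXU -!tnth_nth !tnth_mktuple sij subrr.
rewrite subr_eq0 => /eqP /(congr1 (mcoeff U_(j))); rewrite !mcoeffXU eqxx.
by case: eqP => // _ /esym/eqP; rewrite oner_eq0.
Qed.

End AlgebraicIndependence.

(** * Chains and cochains modulo 2 *)

Section Chains.
Variable T : Type.
Implicit Types (s t : seq T) (c : seq (seq T)) (phi psi : seq T -> bool).

(** A simplex is the ordered list of its vertices, repetitions allowed; a chain modulo 2 is a list
    of simplices. *)
Fixpoint facets s : seq (seq T) :=
  if s is x :: s' then s' :: map (cons x) (facets s') else [::].

(** The pairing of a cochain with a chain; statements about boundaries are expressed dually through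
    it. *)
Definition csum phi c : bool := \big[addb/false]_(s <- c) phi s.

Definition cobd phi s : bool := csum phi (facets s).

Lemma csum0 c : csum (fun=> false) c = false.
Proof. exact: big1_idem. Qed.

Lemma csum1 phi s : csum phi [:: s] = phi s.
Proof. by rewrite /csum big_seq1. Qed.

Lemma csum_cat phi c1 c2 : csum phi (c1 ++ c2) = csum phi c1 (+) csum phi c2.
Proof. exact: big_cat. Qed.

Lemma csum_map phi f c : csum phi (map f c) = csum (phi \o f) c.
Proof. exact: big_map. Qed.

Lemma csum_addb phi psi c :
  csum (fun s => phi s (+) psi s) c = csum phi c (+) csum psi c.
Proof. exact: big_split. Qed.

Lemma eq_csum phi psi c : phi =1 psi -> csum phi c = csum psi c.
Proof. by move=> h; apply: eq_bigr => s _; exact: h. Qed.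

Lemma csum_flatten phi (f : seq T -> seq (seq T)) c :
  csum phi (flatten (map f c)) = csum (fun s => csum phi (f s)) c.
Proof. by rewrite /csum big_flatten big_map. Qed.

Lemma cobd_cons phi x s : cobd phi (x :: s) = phi s (+) cobd (phi \o cons x) s.
Proof. by rewrite /cobd /= /csum big_cons big_map. Qed.

Lemma eq_cobd phi psi : phi =1 psi -> cobd phi =1 cobd psi.
Proof. by move=> h s; apply: eq_csum. Qed.

Lemma cobd_addb phi psi s :
  cobd (fun s => phi s (+) psi s) s = cobd phi s (+) cobd psi s.
Proof. exact: csum_addb. Qed.

Lemma cobd_cobd phi s : cobd (cobd phi) s = false.
Proof.
elim: s phi => [|x s IH] phi; first by rewrite /cobd /csum big_nil.
rewrite cobd_cons (eq_cobd (cobd_cons phi x : _ \o _ =1 _)) cobd_addb IH addbF.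
exact: addbb.
Qed.

End Chains.

Lemma map_facets (T U : Type) (f : T -> U) s :
  facets (map f s) = map (map f) (facets s).
Proof. by elim: s => //= x s ->; rewrite -!map_comp. Qed.

Lemma mem_facets (T : eqType) (s t : seq T) : t \in facets s ->
  size s = (size t).+1 /\ {subset t <= s}.
Proof.
elim: s t => //= x s IH t; rewrite inE => /orP[/eqP ->|/mapP[u us ->]].
  by split=> // v vs; rewrite inE vs orbT.
have [-> us'] := IH _ us; split=> // v.
by rewrite !inE => /orP[->//|/us' ->]; rewrite orbT.
Qed.

Lemma eq_in_csum (T : eqType) (phi psi : seq T -> bool) c :
  {in c, phi =1 psi} -> csum phi c = csum psi c.
Proof. by move=> h; apply: eq_big_seq. Qed.

(** * Cup products of coboundaries of sign functions *)

Section Cup.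
Variables (T : eqType) (s : nat -> T -> bool).
Implicit Types (t : seq T) (f : T -> bool) (phi : seq T -> bool).

(** Cup product of the 0-cochain [f] with [phi]: the front face is the first vertex, the back face
    the whole simplex. *)
Definition cup f phi t := if t is v :: _ then f v && phi t else false.

(** Cup product of the coboundary of [f], taken on the first edge, with [phi] on the face opposite
    the first vertex. *)
Definition cupd f phi t :=
  if t is v :: ((w :: _) as t') then (f v (+) f w) && phi t' else false.

Lemma csum_andb b phi c : csum (fun t => b && phi t) c = b && csum phi c.
Proof. by case: b => //=; rewrite csum0. Qed.

(** The Leibniz rule modulo 2. The condition on [phi] serves the one-vertex simplex, whose only
    facet is the empty list. *)
Lemma cobd_cup f phi t : phi [::] = false ->
  cobd (cup f phi) t = cupd f phi t (+) cup f (cobd phi) t.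
Proof.
move=> phi0; case: t => [|v [|w t]]; first by rewrite /cobd /csum big_nil.
  by rewrite /= /cobd /csum !big_seq1 /= phi0 andbF.
rewrite cobd_cons.
have -> : cup f (cobd phi) (v :: w :: t) =
    f v && (phi (w :: t) (+) cobd (phi \o cons v) (w :: t)) by rewrite -cobd_cons.
have -> : cobd (cup f phi \o cons v) (w :: t) = f v && cobd (phi \o cons v) (w :: t).
  exact: csum_andb.
rewrite /=; set x := phi _; set y := cobd _ _.
by case: (f v) (f w) x y => [] [] [] [].
Qed.

(* The i-fold cup product of the coboundaries of s i.-1, ..., s 0, an
   i-cochain: it vanishes on lists not of size i.+1. *)
Fixpoint cupprod i t := if i is i'.+1 then cupd (s i') (cupprod i') t else size t == 1%N.

Lemma cupprod0 i : cupprod i [::] = false. Proof. by case: i. Qed.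

(** By the Leibniz rule a product of positive degree is itself a coboundary; in degree 0 the two
    endpoints of an edge cancel. *)
Lemma cobd_cupprod i t : cobd (cupprod i) t = false.
Proof.
elim: i t => [|i IH] t.
  case: t => [|u [|v [|w t]]]; rewrite /cobd.
  - by rewrite /csum big_nil.
  - by rewrite /csum big_seq1.
  - by rewrite /csum !big_cons big_nil.
  rewrite -(csum0 (facets [:: u, v, w & t])).
  by apply: eq_in_csum => -[|x [|y r]] // /mem_facets[].
have h : cobd (cup (s i) (cupprod i)) =1 cupprod i.+1.
  move=> u; rewrite cobd_cup ?cupprod0 //; case: u => [|x u] //=; by rewrite IH andbF addbF.
by rewrite -(eq_cobd h) cobd_cobd.
Qed.

Lemma cobd_cup_cupprod i : cobd (cup (s i) (cupprod i)) =1 cupprod i.+1.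
Proof.
move=> u; rewrite cobd_cup ?cupprod0 //; case: u => [|x u] //=.
by rewrite cobd_cupprod andbF addbF.
Qed.

(** The value is a product of factors [s i v (+) s i w] over consecutive vertices, none of which may
    vanish. *)
Lemma cupprod_change m t : cupprod m t -> forall i, (i < m)%N ->
  exists u v, [/\ u \in t, v \in t, s i u & ~~ s i v].
Proof.
elim: m t => // m IH [|v [|w t]] //= /andP[vw /IH wt] i.
rewrite ltnS leq_eqVlt => /orP[/eqP ->|/wt[x [y [xt yt sx sy]]]]; last first.
  by exists x, y; split; rewrite // inE ?xt ?yt orbT.
case sv : (s m v) vw => /= sw; [exists v, w|exists w, v].
  by split; rewrite ?inE ?eqxx ?orbT.
by rewrite -[s m w]negbK sw; split; rewrite ?inE ?eqxx ?orbT ?sv.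
Qed.

Variable nu : T -> T.

Lemma cupprod_nu i t : {in t, forall v j, s j (nu v) = ~~ s j v} ->
  cupprod i (map nu t) = cupprod i t.
Proof.
elim: i t => [|i IH] [|v [|w t]] //= st.
rewrite -[nu w :: _]/(map nu (w :: t)) IH => [|x xt]; last first.
  by apply: st; rewrite inE xt orbT.
by rewrite !st ?inE ?eqxx ?orbT // addbN addNb negbK.
Qed.

(* The first hypothesis says, dually, that [c i.+1] has boundary
   [c i + nu (c i)] modulo 2. *)
Lemma csum_cupprod (c : nat -> seq (seq T)) m :
  (forall i, (i < m)%N -> forall phi,
     csum (cobd phi) (c i.+1) = csum phi (c i) (+) csum (phi \o map nu) (c i)) ->
  (forall i, (i <= m)%N -> forall t, t \in c i ->
     {in t, forall v j, s j (nu v) = ~~ s j v}) ->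
  csum (cupprod m) (c m) = csum (cupprod 0) (c 0%N).
Proof.
elim: m => // m IH bdc oddc; rewrite -IH; last first.
- by move=> i im; apply: oddc; exact: ltnW.
- by move=> i im; apply: bdc; exact: ltnW.
(* On [t] and its image under [nu] the factor [cupprod m] agrees, while the values of [s m] at the
   first vertex are complementary; the two terms add up to [cupprod m t]. *)
rewrite -(eq_csum _ (cobd_cup_cupprod m)) bdc // -csum_addb.
apply: eq_in_csum => t tc; have tP := oddc m (leqnSn m) t tc.
case: t tP {tc} => [|v t] tP /=.
  by case: m {IH bdc oddc tP}.
rewrite -[nu v :: _]/(map nu (v :: t)) cupprod_nu // tP ?inE ?eqxx //.
by case: (s m v); rewrite ?addbF.
Qed.

End Cup.

(** * Barycentric subdivision and sign changes of odd functions *)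

Section Subdivision.
Variables (R : realType) (M : nat).
Local Notation V := 'rV[R]_M.
Implicit Types (t : seq V) (phi : seq V -> bool).

Definition bary t : V := (size t)%:R^-1 *: \sum_(v <- t) v.

(** [n] is fuel. For [n = size t] each simplex lists the barycenters of a flag of faces of [t], from
    [t] down to a vertex. *)
Fixpoint sdn n t : seq (seq V) :=
  if n is n'.+1 then map (cons (bary t)) (flatten (map (sdn n') (facets t)))
  else [:: [::]].

Definition sd t := sdn (size t) t.

Definition sdc (c : seq (seq V)) := flatten (map sd c).

Lemma sdE v t : sd (v :: t) = map (cons (bary (v :: t))) (sdc (facets (v :: t))).
Proof.
rewrite -[LHS]/(map _ (flatten (map (sdn (size t)) (facets (v :: t))))).
congr (map _ (flatten _)).
by apply/eq_in_map => u /mem_facets[[su] _]; rewrite /sd su.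
Qed.

(** The dual of subdivision commuting with the boundary. The subdivision is a cone over the
    subdivided boundary; its boundary is the base plus the cone over the boundary of the base, which
    vanishes by induction and [cobd_cobd]. *)
Lemma cobd_sd phi t :
  csum (cobd phi) (sd t) = cobd (fun u => csum phi (sd u)) t.
Proof.
have [n] := ubnP (size t); elim: n t phi => // n IH [|v t] phi tn.
  by rewrite /sd /= csum1 /cobd /= /csum !big_nil.
rewrite sdE csum_map; set b := bary _.
rewrite (@eq_csum _ _ (fun u => phi u (+) cobd (phi \o cons b) u)); last first.
  by move=> u; rewrite /= cobd_cons.
rewrite csum_addb csum_flatten -[csum _ (facets _)]/(cobd _ _).
suff -> : csum (cobd (phi \o cons b)) (sdc (facets (v :: t))) = false by rewrite addbF.
rewrite csum_flatten (@eq_in_csum _ _ (cobd (fun u => csum (phi \o cons b) (sd u)))).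
  exact: cobd_cobd.
by move=> u /mem_facets[su _]; apply: IH; rewrite -su.
Qed.

Local Notation opp := (map (fun v : V => - v)).

Lemma bary_opp t : bary (opp t) = - bary t.
Proof. by rewrite /bary size_map big_map sumrN scalerN. Qed.

Lemma sd_opp t : sd (opp t) = map opp (sd t).
Proof.
rewrite /sd size_map; move: (size t) => n.
elim: n t => // n IH t /=.
have -> : map (sdn n) (facets (opp t)) = map (map opp) (map (sdn n) (facets t)).
  by rewrite map_facets -!map_comp; apply: eq_map => u; exact: IH.
rewrite bary_opp -map_flatten -!map_comp; exact: eq_map.
Qed.

Lemma size_sd t u : u \in sd t -> size u = size t.
Proof.
have [n] := ubnP (size t); elim: n t u => // n IH [|v t] u tn.
  by rewrite inE => /eqP ->.
rewrite sdE => /mapP[w /flatten_mapP[x xt wx] ->].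
have [[sx] _] := mem_facets xt.
by rewrite /= (IH x) -?sx.
Qed.

Lemma sd_closed (Q : V -> Prop) t :
  (forall u, u != [::] -> {in u, forall v, Q v} -> Q (bary u)) ->
  {in t, forall v, Q v} -> forall u, u \in sd t -> {in u, forall v, Q v}.
Proof.
move=> Qb; have [n] := ubnP (size t); elim: n t => // n IH [|v t] tn tQ u.
  by rewrite inE => /eqP ->.
rewrite sdE => /mapP[w /flatten_mapP[x xt wx] ->] y.
rewrite inE => /orP[/eqP ->|]; first exact: Qb.
have [sx xs] := mem_facets xt.
by apply: (IH x) => //; [rewrite -ltnS -sx|move=> z /xs; exact: tQ].
Qed.

Lemma baryE t (i : 'I_M) : bary t 0 i = (size t)%:R^-1 * \sum_(v <- t) v 0 i.
Proof. by rewrite mxE summxE. Qed.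

Definition mesh (e : R) t := {in t &, forall u v : V, forall i, `|u 0 i - v 0 i| <= e}.

(** The difference is the average of [u - v] over [u] in [t], in which a term with [u = v]
    vanishes. *)
Lemma bary_dist (e : R) t v i : mesh e t -> v \in t ->
  `|bary t 0 i - v 0 i| <= (size t).-1%:R / (size t)%:R * e.
Proof.
move=> te vt.
have st : (size t)%:R != 0 :> R by rewrite pnatr_eq0; case: t vt {te}.
have -> : bary t 0 i - v 0 i = (size t)%:R^-1 * \sum_(u <- t) (u 0 i - v 0 i).
  rewrite baryE sumrB big_const_seq count_predT iter_addr_0.
  by rewrite -[v 0 i *+ _]mulr_natl mulrBr mulKf.
rewrite normrM ger0_norm ?invr_ge0 // [_%:R / _]mulrC -mulrA.
rewrite ler_pM2l ?invr_gt0 ?lt0r ?st ?ler0n //.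
rewrite (perm_big _ (perm_to_rem vt)) big_cons /= subrr add0r.
apply: (le_trans (ler_norm_sum _ _ _)).
apply: (le_trans (y := \sum_(u <- rem v t) e)).
  by rewrite big_seq [leRHS]big_seq; apply: ler_sum => u /mem_rem ut; exact: te.
by rewrite big_const_seq count_predT iter_addr_0 size_rem // mulr_natl.
Qed.

Lemma sd_mesh (e : R) n t : 0 <= e -> (size t <= n.+1)%N -> mesh e t ->
  forall u, u \in sd t -> mesh (n%:R / n.+1%:R * e) u.
Proof.
move=> e0 tn te; have [k] := ubnP (size t); elim: k t tn te => // k IH [|v t] tn te tk u.
  by rewrite inE => /eqP -> x y; rewrite in_nil.
rewrite sdE => /mapP[w /flatten_mapP[x xt wx] ->].
have [[sx] xs] := mem_facets xt.
have wmesh : mesh (n%:R / n.+1%:R * e) w.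
  apply: (IH x) => //; first by rewrite -sx ltnW.
    by move=> y z /xs yt /xs; exact: te.
  by rewrite -sx.
have q_le : (size t)%:R / (size t).+1%:R <= n%:R / n.+1%:R :> R.
  rewrite ler_pdivrMr ?ltr0n // mulrAC ler_pdivlMr ?ltr0n // -!natrM ler_nat.
  by rewrite mulnS mulnS [(n * size t)%N]mulnC leq_add2r.
(* The bound holds at the vertices of the facet [x] by [bary_dist] and passes to those of its
   subdivision by convexity. *)
have bw y i : y \in w -> `|bary (v :: t) 0 i - y 0 i| <= n%:R / n.+1%:R * e.
  move=> yw; set b := bary _.
  apply: (@sd_closed (fun y => `|b 0 i - y 0 i| <= n%:R / n.+1%:R * e) x _ _ w) => //.
    move=> z z0 zb.
    have sz : (size z)%:R != 0 :> R by rewrite pnatr_eq0; case: z z0 {zb}.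
    have -> : b 0 i - bary z 0 i = (size z)%:R^-1 * \sum_(u <- z) (b 0 i - u 0 i).
      rewrite baryE sumrB big_const_seq count_predT iter_addr_0.
      by rewrite -[b 0 i *+ _]mulr_natl mulrBr mulKf.
    rewrite normrM ger0_norm ?invr_ge0 // mulrC ler_pdivrMr ?lt0r ?sz ?ler0n //.
    apply: (le_trans (ler_norm_sum _ _ _)).
    apply: (le_trans (y := \sum_(u <- z) (n%:R / n.+1%:R * e))).
      by rewrite big_seq [leRHS]big_seq; apply: ler_sum => u'; exact: zb.
    by rewrite big_const_seq count_predT iter_addr_0 mulr_natr.
  move=> z /xs zt; apply: (le_trans (bary_dist _ te zt)).
  by rewrite ler_wpM2r.
move=> y z; rewrite !inE => /orP[/eqP ->|yw] /orP[/eqP ->|zw] i.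
- by rewrite subrr normr0 mulr_ge0 // divr_ge0.
- exact: bw.
- by rewrite distrC; exact: bw.
- exact: wmesh.
Qed.

End Subdivision.

(** * The octahedral sphere and the Borsuk-Ulam theorem for sign functions *)

Section BorsukUlam.
Variables (R : realType) (m : nat).
Local Notation V := 'rV[R]_m.+1.
Local Notation opp := (map (fun v : V => - v)).

Definition vert (j : nat) : V := delta_mx 0 (inord j).

(** A hemisphere of dimension [i]: the cone from [vert i] over the sphere formed by the previous
    hemisphere and its antipode. *)
Fixpoint octa (i : nat) : seq (seq V) :=
  if i is i'.+1 then map (cons (vert i)) (octa i' ++ map opp (octa i'))
  else [:: [:: vert 0]].

Lemma oppK : involutive opp.
Proof. by move=> t; rewrite -map_comp map_id_in // => v _ /=; rewrite opprK. Qed.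

(** Modulo 2 a hemisphere and its antipode have the same boundary, so in the boundary of the cone
    only the base remains. *)
Lemma octa_bd i phi :
  csum (cobd phi) (octa i.+1) = csum phi (octa i) (+) csum (phi \o opp) (octa i).
Proof.
have cobd_opp (psi : seq V -> bool) t : cobd psi (opp t) = cobd (psi \o opp) t.
  by rewrite /cobd map_facets csum_map.
elim: i phi => [|i IH] phi.
  rewrite /octa csum_map !csum_cat csum_map !csum1 /=.
  by rewrite /cobd /csum /= !big_cons !big_nil /= !addbF addbACA addbb addbF.
rewrite [octa i.+2]/= -/(octa i.+1); move: (octa i.+1) IH => c IH.
rewrite csum_map (@eq_csum _ _ (fun u => phi u (+) cobd (phi \o cons (vert i.+2)) u)).
  set psi := phi \o cons _; rewrite csum_addb !csum_cat !csum_map.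
  have -> : csum (cobd psi \o opp) c = csum (cobd (psi \o opp)) c.
    by apply: eq_csum => t; exact: cobd_opp.
  have := IH psi; have := IH (psi \o opp).
  rewrite (@eq_csum _ ((psi \o opp) \o opp) psi); last by move=> u /=; rewrite oppK.
  by rewrite addbC => <- ->; rewrite addbb addbF.
by move=> u; rewrite /= cobd_cons.
Qed.

Definition sphere_signs (eps : 'I_m.+1 -> R) := forall j, eps j = 1 \/ eps j = -1.

(** For signs [eps] this is a face of the unit sphere of the l1 norm: convex, hence stable under
    subdivision, and away from 0. *)
Definition orthant (eps : 'I_m.+1 -> R) (v : V) :=
  (forall j, 0 <= eps j * v 0 j) /\ \sum_j eps j * v 0 j = 1.

Lemma octa_orthant i t : (i <= m)%N -> t \in octa i ->
  size t = i.+1 /\ exists eps, sphere_signs eps /\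
  {in t, forall v, exists2 j : 'I_m.+1, (j <= i)%N & v = eps j *: delta_mx 0 j}.
Proof.
elim: i t => [|i IH] t im.
  rewrite inE => /eqP ->; split=> //; exists (fun=> 1); split; first by left.
  move=> v; rewrite inE => /eqP ->; exists (inord 0); last by rewrite scale1r.
  by rewrite inordK.
have step u : size u = i.+1 /\ (exists eps, sphere_signs eps /\
    {in u, forall v, exists2 j : 'I_m.+1, (j <= i)%N & v = eps j *: delta_mx 0 j}) ->
    size (vert i.+1 :: u) = i.+2 /\ exists eps, sphere_signs eps /\
    {in vert i.+1 :: u, forall v, exists2 j : 'I_m.+1,
         (j <= i.+1)%N & v = eps j *: delta_mx 0 j}.
  move=> [su [eps [es epsu]]]; split; first by rewrite /= su.
  (* The vertices of [u] only involve indices up to [i], so the sign at [i.+1] is free. *)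
  exists (fun j => if val j == i.+1 then 1 else eps j); split.
    by move=> j; case: eqP => _; [left|exact: es].
  move=> v; rewrite inE => /orP[/eqP ->|/epsu[j ji ->]].
    exists (inord i.+1); first by rewrite inordK.
    by rewrite /= inordK // eqxx scale1r.
  exists j; first exact: leqW.
  by rewrite /= ltn_eqF.
move=> /mapP[u + ->]; rewrite mem_cat => /orP[uc|/mapP[w wc ->]].
  by apply: step; apply: IH; first exact: ltnW.
apply: step; case: (IH w (ltnW im) wc) => sw [eps [es epsw]]; split; first by rewrite size_map.
exists (fun j => - eps j); split.
  by move=> j; case: (es j) => ->; [right|left; rewrite opprK].
move=> v /mapP[x /epsw[j ji ->] ->]; exists j => //.
by rewrite scaleNr.
Qed.

Lemma orthant_bary eps u : u != [::] -> {in u, forall v, orthant eps v} ->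
  orthant eps (bary u).
Proof.
move=> u0 uo; have su : (size u)%:R != 0 :> R by rewrite pnatr_eq0; case: u u0 {uo}.
split=> [j|].
  rewrite baryE mulrCA mulr_ge0 ?invr_ge0 // mulr_sumr big_seq.
  by apply: sumr_ge0 => v /uo[].
under eq_bigr do rewrite baryE mulrCA mulr_sumr.
rewrite -mulr_sumr exchange_big big_seq.
under eq_bigr => v vu do rewrite (uo v vu).2.
by rewrite -big_seq big_const_seq count_predT iter_addr_0 mulVf.
Qed.

Fixpoint octa_sd N i := if N is N'.+1 then sdc (octa_sd N' i) else octa i.

Lemma octa_sd_bd N i phi :
  csum (cobd phi) (octa_sd N i.+1) =
  csum phi (octa_sd N i) (+) csum (phi \o opp) (octa_sd N i).
Proof.
elim: N phi => [|N IH] phi; first exact: octa_bd.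
rewrite /= !csum_flatten -[RHS]/(csum _ _ (+) csum _ _).
rewrite (@eq_csum _ _ (cobd (fun u => csum phi (sd u)))); last by move=> u; exact: cobd_sd.
rewrite IH; congr (_ (+) _); apply: eq_csum => u /=.
by rewrite sd_opp csum_map.
Qed.

Lemma octa_sd0 N : octa_sd N 0 = [:: [:: vert 0]].
Proof.
elim: N => //= N ->; rewrite /sdc /sd /= /bary big_seq1 /=.
by rewrite invr1 scale1r.
Qed.

Lemma octa_sd_orthant N i t : (i <= m)%N -> t \in octa_sd N i ->
  exists2 eps, sphere_signs eps & {in t, forall v, orthant eps v}.
Proof.
move=> im; elim: N t => [|N IH] t /=.
  move=> /(octa_orthant im)[_ [eps [es epst]]]; exists eps => // v /epst[j _ ->].
  have ee : eps j * eps j = 1 by case: (es j) => ->; rewrite ?mulrNN mulr1.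
  split=> [k|].
    by rewrite !mxE eqxx /=; case: eqP => [->|_]; rewrite ?mulr0 // mulr1 ee.
  rewrite (bigD1 j) //= !mxE !eqxx mulr1 ee big1 ?addr0 // => k kj.
  by rewrite !mxE (negbTE kj) andbF !mulr0.
move=> /flatten_mapP[u /IH[eps es epsu] tu]; exists eps => //.
by apply: sd_closed tu => //; exact: orthant_bary.
Qed.

Lemma octa_sd_mesh N t : t \in octa_sd N m ->
  size t = m.+1 /\ mesh ((m%:R / m.+1%:R) ^+ N * 2 : R) t.
Proof.
elim: N t => [|N IH] t.
  move=> /(octa_orthant (leqnn m))[st [eps [es epst]]]; split=> // u v ut vt i.
  have bnd w : w \in t -> `|w 0 i| <= 1.
    move=> /epst[j _ ->]; rewrite !mxE eqxx /=.
    by case: (es j) => ->; case: eqP => _; rewrite ?mulr1 ?mulr0 ?normrN ?normr1 ?normr0.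
  rewrite expr0 mul1r (le_trans (ler_normB _ _)) // (_ : 2 = 1 + 1) //.
  by rewrite lerD // bnd.
move=> /flatten_mapP[u /IH[su mu] tu]; split; first by rewrite (size_sd tu).
by rewrite exprS -mulrA; apply: sd_mesh tu => //; rewrite ?su //.
Qed.

(** A boolean sign cannot be odd at 0, where [- v = v]. *)
Definition odd_on_nonzero (s : V -> bool) := forall v, v != 0 -> s (- v) = ~~ s v.

Lemma orthant_neq0 eps v : orthant eps v -> v != 0.
Proof.
move=> [_ v1]; apply/eqP => v0; move: v1; rewrite v0.
under eq_bigr do rewrite mxE mulr0.
by rewrite big1 // => /esym/eqP; rewrite oner_eq0.
Qed.

Lemma orthant_l1 eps v : sphere_signs eps -> orthant eps v -> \sum_j `|v 0 j| = 1.
Proof.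
move=> es [v0 <-]; apply: eq_bigr => j _.
by rewrite -[RHS]ger0_norm // normrM; case: (es j) => ->; rewrite ?normrN normr1 mul1r.
Qed.

(** The top cup product has the same value on [octa_sd N m] as the product of degree 0 on the single
    vertex of [octa_sd N 0], namely 1. *)
Lemma octa_sd_change (s : nat -> V -> bool) N : (forall i, odd_on_nonzero (s i)) ->
  exists2 t, t \in octa_sd N m & forall i, (i < m)%N ->
    exists u v, [/\ u \in t, v \in t, s i u & ~~ s i v].
Proof.
move=> sodd; have : csum (cupprod s m) (octa_sd N m) = true.
  rewrite (@csum_cupprod _ s -%R (octa_sd N)) ?octa_sd0 ?csum1 //.
    by move=> i _ phi; exact: octa_sd_bd.
  move=> i im t /(octa_sd_orthant im)[eps _ epst] v /epst /orthant_neq0 v0 j.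
  exact: sodd.
move=> h; have [/hasP[t tc tm]|/hasPn no] := boolP (has (cupprod s m) (octa_sd N m)).
  by exists t => //; exact: cupprod_change.
move: h; rewrite (@eq_in_csum _ _ (fun=> false)) ?csum0 // => t /no.
exact: negbTE.
Qed.

(* Each s i changes in every neighbourhood of w; for s i the sign of an odd
   continuous function f i this is the Borsuk-Ulam theorem, as then f i w = 0. *)
Lemma borsuk_ulam_signs (s : nat -> V -> bool) : (forall i, odd_on_nonzero (s i)) ->
  exists2 w : V, w != 0 & forall e, 0 < e -> forall i, (i < m)%N ->
    exists u v, [/\ s i u, ~~ s i v, forall j, `|u 0 j - w 0 j| < e &
                   forall j, `|v 0 j - w 0 j| < e].
Proof.
move=> sodd; pose q : R := m%:R / m.+1%:R.
have q0 : 0 <= q by rewrite divr_ge0.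
have q1 : q < 1 by rewrite ltr_pdivrMr ?ltr0n // mul1r ltr_nat.
have hx N : exists x : V, \sum_j `|x 0 j| = 1 /\ forall i, (i < m)%N ->
    exists u v, [/\ s i u, ~~ s i v, forall j, `|u 0 j - x 0 j| <= q ^+ N * 2 &
                   forall j, `|v 0 j - x 0 j| <= q ^+ N * 2].
  have [t tc tP] := octa_sd_change N sodd.
  have [eps es epst] := octa_sd_orthant (leqnn m) tc.
  have [st mt] := octa_sd_mesh tc.
  have [x xt] : exists x, x \in t.
    by case: t st {tc tP epst mt} => // x t _; exists x; rewrite inE eqxx.
  exists x; split; first exact: orthant_l1 es (epst x xt).
  move=> i /tP[u [v [ut vt su sv]]]; exists u, v; split=> // j; exact: mt.
have [x xP] := boolp.choice hx.
pose K : set V := [set v | forall j, `[(-1), 1]%classic (v ord0 j)].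
have cK : compact K.
  apply: (@rV_compact R m.+1 (fun=> `[(-1), 1]%classic)) => _.
  exact: segment_compact.
have Kx N : K (x N).
  move=> j /=; rewrite in_itv /= -ler_norml -(xP N).1 (bigD1 j) //= lerDl.
  exact: sumr_ge0.
have FK : (x @ \oo) K by exists 0%N => // N _; exact: Kx.
have [w [_ wcl]] := cK (x @ \oo) _ FK.
have near_w e N0 : 0 < e -> exists2 N, (N0 <= N)%N & forall j, `|x N 0 j - w 0 j| < e.
  move=> e0.
  have [] := wcl [set x N | N in [set N | (N0 <= N)%N]] (ball w e).
  - by exists N0 => // N /= N0N; exists N.
  - exact: nbhsx_ballx.
  move=> _ [[N N0N <-] wx]; exists N => // j.
  by have := wx.2 ord0 j; rewrite /ball /= distrC.
exists w.
  (* If [w] were 0, some [x N] would have m+1 coordinates below 1/(m+1) in absolute value, against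
     its l1 norm 1. *)
  apply/eqP => w0; have [|N _] := near_w (m.+1%:R^-1) 0%N; first by rewrite invr_gt0.
  rewrite w0 => h; have := (xP N).1; apply/eqP; rewrite lt_eqF //.
  rewrite (lt_le_trans (y := \sum_(j < m.+1) m.+1%:R^-1)) //.
    apply: ltr_sum; first by apply/hasP; exists ord0 => //; rewrite mem_index_enum.
    by move=> j _; have := h j; rewrite mxE subr0.
  by rewrite sumr_const card_ord -[_^-1 *+ _]mulr_natl mulfV.
move=> e e0 i im; have e20 : 0 < e / 2 by rewrite divr_gt0.
(* One half of [e] covers the mesh, the other the distance from [x N] to [w]. *)
have [N0 N0P] : exists N0, forall N, (N0 <= N)%N -> q ^+ N * 2 < e / 2.
  have : q ^+ n @[n --> \oo] --> 0 by apply: cvg_expr; rewrite ger0_norm.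
  move=> /cvgrPdist_lt /(_ (e / 4)); rewrite divr_gt0 // => /(_ isT)[N0 _ h].
  exists N0 => N /h /=; rewrite sub0r normrN ger0_norm ?exprn_ge0 //.
  by lra.
have [N N0N xw] := near_w (e / 2) N0 e20.
have [u [v [su sv ux vx]]] := (xP N).2 i im.
exists u, v; split=> // j.
  rewrite (le_lt_trans (ler_distD (x N 0 j) _ _)) // [e]splitr ltrD //.
  by rewrite (le_lt_trans (ux j)) // N0P.
rewrite (le_lt_trans (ler_distD (x N 0 j) _ _)) // [e]splitr ltrD //.
by rewrite (le_lt_trans (vx j)) // N0P.
Qed.

End BorsukUlam.

(** * Ham-sandwich cuts *)

Section HamSandwich.
Variables (R : realType) (m : nat).
Local Notation V := 'rV[R]_m.+1.

Definition dot (w x : V) : R := \sum_j w 0 j * x 0 j.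

Lemma dotN w x : dot (- w) x = - dot w x.
Proof. by rewrite /dot -sumrN; apply: eq_bigr => j _; rewrite mxE mulNr. Qed.

(** Lexicographic positivity; as a tie-break it makes [majority] odd at every nonzero vector. *)
Definition lexpos (w : V) : bool :=
  [exists j, (0 < w 0 j) && [forall k : 'I_m.+1, (k < j)%N ==> (w 0 k == 0)]].

Lemma lexpos_first (w : V) (j : 'I_m.+1) : w 0 j != 0 ->
  (forall k : 'I_m.+1, (k < j)%N -> w 0 k = 0) -> lexpos w = (0 < w 0 j).
Proof.
move=> wj wk; apply/existsP/idP => [[i /andP[wi /forallP iP]]|w0].
  case: (ltngtP i j) => [/wk wi0|ji|/val_inj <- //].
    by rewrite wi0 ltxx in wi.
  by have /implyP/(_ ji) := iP j; rewrite (negbTE wj).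
by exists j; rewrite w0; apply/forallP => k; apply/implyP => /wk ->.
Qed.

Lemma lexpos_odd : odd_on_nonzero lexpos.
Proof.
move=> w w0.
have [j0 wj0] : exists j, w 0 j != 0.
  apply: contrapT => no; move/eqP: w0; apply; apply/rowP => j; rewrite mxE.
  by apply/eqP/negP => /negP wj; apply: no; exists j.
have [j wj jmin] := @arg_minnP _ j0 (fun j => w 0 j != 0) val wj0.
have wk (k : 'I_m.+1) : (k < j)%N -> w 0 k = 0.
  by move=> kj; apply/eqP; apply: contraTT kj => /jmin; rewrite -leqNgt.
rewrite (lexpos_first wj wk) (@lexpos_first _ j).
- by rewrite mxE oppr_gt0 -leNgt le_eqVlt (negbTE wj).
- by rewrite mxE oppr_eq0.
- by move=> k /wk wk0; rewrite mxE wk0 oppr0.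
Qed.

Definition npos (w : V) (X : seq V) := count (fun x => 0 < dot w x) X.

Definition majority (X : seq V) (w : V) : bool :=
  (npos (- w) X < npos w X)%N || (npos (- w) X == npos w X) && lexpos w.

Lemma majority_odd X : odd_on_nonzero (majority X).
Proof.
move=> w w0; rewrite /majority opprK (lexpos_odd w0) eq_sym.
by case: ltngtP => //= _; case: (lexpos w).
Qed.

Lemma npos_size w X : (npos w X + npos (- w) X <= size X)%N.
Proof.
elim: X => //= x X IH; rewrite addnACA -[(size X).+1]add1n leq_add //.
by rewrite dotN oppr_gt0; case: ltgtP.
Qed.

(** Strict positivity of each [dot w x] is an open condition on [w]. *)
Lemma npos_open (w : V) (X : seq V) : exists2 e, 0 < e &
  forall u : V, (forall j, `|u 0 j - w 0 j| < e) -> (npos w X <= npos u X)%N.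
Proof.
elim: X => [|x X [e e0 eP]]; first by exists 1.
have [wx|wx] := leP (dot w x) 0; last first.
  (* The summand 1 keeps [S] positive and the final estimate strict. *)
  pose S := 1 + \sum_j `|x 0 j|.
  have S0 : 0 < S by rewrite ltr_pwDl // sumr_ge0.
  exists (Num.min e (dot w x / S)); first by rewrite lt_min e0 divr_gt0.
  move=> u uP; rewrite /npos /= wx leq_add //; last first.
    by apply: eP => j; move: (uP j); rewrite lt_min => /andP[].
  have ux : `|dot u x - dot w x| < dot w x.
    rewrite /dot -sumrB; apply: (le_lt_trans (ler_norm_sum _ _ _)).
    apply: (le_lt_trans (y := \sum_j dot w x / S * `|x 0 j|)).
      apply: ler_sum => j _; rewrite -mulrBl normrM ler_wpM2r //.
      by move: (uP j); rewrite lt_min => /andP[_ /ltW].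
    rewrite -mulr_sumr mulrAC ltr_pdivrMr // ltr_pM2l // /S.
    by rewrite ltrDr.
  by move: ux; rewrite ltr_norml => /andP[ux _]; suff -> : 0 < dot u x by []; lra.
exists e => // u uP; rewrite /npos /= (le_gtF wx) add0n.
by rewrite (leq_trans (eP u uP)) // leq_addl.
Qed.

(** Arbitrarily near [w] there are [u] with the majority on its positive side or a tie, and [v] with
    the opposite. So [- u] and [v] are positive on at most half of the points, and by [npos_open]
    the counts for [- w] and [w] are no larger. *)
Lemma ham_sandwich (X : nat -> seq V) : exists2 w : V, w != 0 &
  forall i, (i < m)%N ->
    ((npos w (X i)).*2 <= size (X i))%N /\ ((npos (- w) (X i)).*2 <= size (X i))%N.
Proof.
have [w w0 wP] := borsuk_ulam_signs (fun i => majority_odd (X i)).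
exists w => // i im.
have [e1 e10 e1P] := npos_open w (X i).
have [e2 e20 e2P] := npos_open (- w) (X i).
have [|u [v [su sv uw vw]]] := wP (Num.min e1 e2) _ i im; first by rewrite lt_min e10.
have h (z : V) : (forall j, `|z 0 j - w 0 j| < Num.min e1 e2) ->
    (npos w (X i) <= npos z (X i))%N /\ (npos (- w) (X i) <= npos (- z) (X i))%N.
  move=> zP; split.
    by apply: e1P => j; move: (zP j); rewrite lt_min => /andP[].
  apply: e2P => j; move: (zP j); rewrite lt_min => /andP[_].
  by rewrite !mxE -opprD normrN.
have [hu1 hu2] := h u uw; have [hv1 hv2] := h v vw.
have := npos_size u (X i); have := npos_size v (X i).
move: su sv; rewrite /majority; lia.
Qed.

End HamSandwich.

(** * Polynomial partitioning *)

Section Degree.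
Variables (R : comNzRingType) (n : nat).
Implicit Types p q : {mpoly R[n]}.

Lemma pdeg_leP p k :
  reflect (forall m, m \in msupp p -> (mdeg m <= k)%N) (pdeg p <= k)%N.
Proof.
rewrite /pdeg; apply: (iffP (bigmax_leqP_seq _ _ _ _)) => [h m mp|h m mp _].
  exact: h.
exact: h.
Qed.

Lemma pdegD_le p q k : (pdeg p <= k)%N -> (pdeg q <= k)%N -> (pdeg (p + q) <= k)%N.
Proof.
move=> /pdeg_leP pk /pdeg_leP qk; apply/pdeg_leP => m /msuppD_le.
by rewrite mem_cat => /orP[/pk|/qk].
Qed.

Lemma pdegZ_le c p k : (pdeg p <= k)%N -> (pdeg (c *: p) <= k)%N.
Proof. by move=> /pdeg_leP pk; apply/pdeg_leP => m /msuppZ_le /pk. Qed.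

Lemma pdeg_sum_le (I : Type) (r : seq I) (P : pred I) (F : I -> {mpoly R[n]}) k :
  (forall i, P i -> (pdeg (F i) <= k)%N) -> (pdeg (\sum_(i <- r | P i) F i) <= k)%N.
Proof.
move=> Fk; apply: (big_ind (fun p => (pdeg p <= k)%N)) => //.
  by apply/pdeg_leP => m; rewrite msupp0.
by move=> p q; exact: pdegD_le.
Qed.

Lemma pdegM_le p q : (pdeg (p * q) <= pdeg p + pdeg q)%N.
Proof.
apply/pdeg_leP => m /msuppM_le /allpairsP[[a b] [/= ap bq ->]].
rewrite mdegD leq_add //.
  by move/pdeg_leP: (leqnn (pdeg p)); apply.
by move/pdeg_leP: (leqnn (pdeg q)); apply.
Qed.

Lemma pdegX (m : 'X_{1..n}) : pdeg ('X_[R, m]) = mdeg m.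
Proof. by rewrite /pdeg msuppX big_seq1. Qed.

Lemma pdeg1 : pdeg (1 : {mpoly R[n]}) = 0%N.
Proof. by rewrite /pdeg msupp1 big_seq1 mdeg0. Qed.

Lemma pdeg_prod_le (I : Type) (r : seq I) (P : pred I) (F : I -> {mpoly R[n]}) :
  (pdeg (\prod_(i <- r | P i) F i) <= \sum_(i <- r | P i) pdeg (F i))%N.
Proof.
apply: (big_ind2 (fun p k => (pdeg p <= k)%N)); first by rewrite pdeg1.
  by move=> p k q l pk ql; rewrite (leq_trans (pdegM_le _ _)) // leq_add.
by [].
Qed.

End Degree.

Lemma pdeg_pull_le (K : fieldType) d n (s : 'I_n -> 'I_d) (p : {mpoly K[n]}) :
  (pdeg (pull s p) <= pdeg p)%N.
Proof.
rewrite /pull comp_mpolyEX big_seq; apply: pdeg_sum_le => m mp; apply: pdegZ_le.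
rewrite comp_mpolyX; apply: (leq_trans (pdeg_prod_le _ _ _)).
apply: (@leq_trans (mdeg m)); last by move/pdeg_leP: (leqnn (pdeg p)); apply.
rewrite mdegE; apply: leq_sum => i _; rewrite tnth_mktuple.
elim: (m i) => [|k IH]; first by rewrite expr0 pdeg1.
by rewrite exprS (leq_trans (pdegM_le _ _)) // pdegX mdeg1 leq_add2l.
Qed.

(** * Iterated polynomial bisection *)

Section Partition.
Variables (R : realType) (k : nat) (U : eqType) (ev : U -> 'I_k -> R).
Implicit Types (g : {mpoly R[k]}) (gs : seq {mpoly R[k]}) (b : seq bool).

(** The ham-sandwich cut is applied after a Veronese map given by m+1 distinct monomials; its normal
    vector [w] becomes the coefficient vector of [g]. *)
Lemma bisecting_poly (m e : nat) (X : nat -> seq U) : (m < e ^ k)%N ->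
  exists g, [/\ g != 0, (pdeg g <= k * e)%N & forall i, (i < m)%N ->
    ((count (fun x => (0 < g.@[ev x])%R) (X i)).*2 <= size (X i))%N /\
    ((count (fun x => (g.@[ev x] < 0)%R) (X i)).*2 <= size (X i))%N].
Proof.
move=> me; have cN : #|{ffun 'I_k -> 'I_e}| = (e ^ k)%N by rewrite card_ffun !card_ord.
have le_m : (m.+1 <= #|{ffun 'I_k -> 'I_e}|)%N by rewrite cN.
(* The first m+1 of the [e ^ k] exponent vectors with entries below [e]. *)
pose mon (j : 'I_m.+1) : 'X_{1..k} :=
  [multinom (enum_val (widen_ord le_m j) i : nat) | i < k].
have mon_inj : injective mon.
  move=> i j ij; apply: val_inj.
  suff /enum_val_inj/(congr1 val) : enum_val (widen_ord le_m i) =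
      enum_val (widen_ord le_m j) by [].
  apply/ffunP => x; apply: val_inj.
  by have /(congr1 (fun M : 'X_{1..k} => M x)) := ij; rewrite !mnmE.
pose phi x : 'rV[R]_m.+1 := \row_j ('X_[mon j] : {mpoly R[k]}).@[ev x].
have [w w0 wP] := ham_sandwich (fun i => map phi (X i)).
pose g : {mpoly R[k]} := \sum_j w 0 j *: 'X_[mon j].
have gE x : g.@[ev x] = dot w (phi x).
  rewrite /g raddf_sum; apply: eq_bigr => j _.
  by rewrite /= mevalZ mxE.
exists g; split.
- apply: contra_neq w0 => g0; apply/rowP => j; rewrite mxE.
  have := congr1 (mcoeff (mon j)) g0; rewrite mcoeff0 /g raddf_sum (bigD1 j) //=.
  rewrite mcoeffZ mcoeffX eqxx mulr1 big1 ?addr0 // => i ij.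
  by rewrite mcoeffZ mcoeffX (inj_eq mon_inj) (negbTE ij) mulr0.
- apply: pdeg_sum_le => j _; apply: pdegZ_le; rewrite pdegX mdegE.
  apply: (@leq_trans (\sum_(i < k) e)%N); last by rewrite sum_nat_const card_ord.
  by apply: leq_sum => i _; rewrite mnmE ltnW.
move=> i /wP; rewrite /npos !count_map size_map => -[h1 h2]; split.
  by apply: leq_trans h1; rewrite leq_double; apply: sub_count => x /=; rewrite gE.
apply: leq_trans h2; rewrite leq_double; apply: sub_count => x /=.
by rewrite gE dotN oppr_gt0.
Qed.

(** Signs are strict: a point where some polynomial of [gs] vanishes lies in no cell. *)
Definition cell gs b (x : U) :=
  all2 (fun g c => if c then 0 < g.@[ev x] else g.@[ev x] < 0) gs b.

Definition partition_degree (J : nat) := (\sum_(j < J) k * 2 ^ (j %/ k).+1)%N.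

Lemma cell_partition (P : seq U) J : (0 < k)%N -> exists gs,
  [/\ all (fun g => g != 0) gs, (\sum_(g <- gs) pdeg g <= partition_degree J)%N, size gs = J
   & forall b, size b = J -> (count (cell gs b) P * 2 ^ J <= size P)%N].
Proof.
move=> k0; elim: J => [|J [gs [gs0 gsd gsJ gsP]]].
  exists [::]; split=> //; first by rewrite big_nil.
  by case=> // _; rewrite muln1 count_size.
(* The cells are numbered by their sign vectors; the default vector only concerns indices from
   [2 ^ J] on. *)
pose X i := [seq x <- P | cell gs (nth [tuple of nseq J true] (enum {: J.-tuple bool}) i) x].
have [|g [g0 gd gP]] := @bisecting_poly (2 ^ J) (2 ^ (J %/ k).+1) X.
  (* There are more monomials than cells because J < k * (J %/ k).+1. *)
  rewrite -expnM ltn_exp2l // mulSn {1}(divn_eq J k) addnC ltn_add2r.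
  exact: ltn_pmod.
exists (g :: gs); split.
- by rewrite /= g0.
- by rewrite big_cons /partition_degree big_ord_recr /= addnC leq_add.
- by rewrite /= gsJ.
case=> [//|c b] [bJ].
have bJ' : size b == J by apply/eqP.
pose i := enum_rank (Tuple bJ').
have iJ : (i < 2 ^ J)%N.
  by rewrite (leq_trans (ltn_ord i)) // card_tuple card_bool.
have Xi : X i = [seq x <- P | cell gs b x].
  by rewrite /X -enum_val_nth (enum_rankK (Tuple bJ')).
have [] := gP i iJ; rewrite Xi !count_filter size_filter => h1 h2.
rewrite expnS mulnCA mulnA (leq_trans _ (gsP b bJ)) // leq_mul //.
rewrite mul2n; case: c.
  by apply: leq_trans h1; rewrite leq_double; apply: sub_count.
by apply: leq_trans h2; rewrite leq_double; apply: sub_count.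
Qed.

Lemma partition_degree_le J : (0 < k)%N ->
  (partition_degree J.+1 <= 4 * k ^ 2 * 2 ^ (J %/ k))%N.
Proof.
move=> k0.
(* The full blocks of k equal terms form a geometric sum, bounded by the summand [k]; [i %% k]
   counts the terms of the incomplete block. *)
have strong i : (\sum_(j < i) 2 ^ (j %/ k).+1 <= (k + i %% k) * 2 ^ (i %/ k).+1)%N.
  elim: i => [|i IH]; first by rewrite big_ord0.
  rewrite big_ord_recr /=; have ik := ltn_pmod i k0.
  have [ik1|] := ltnP (i %% k).+1 k.
    have -> : (i.+1 %/ k = i %/ k)%N.
      by rewrite {1}(divn_eq i k) -addnS divnMDl // (divn_small ik1) addn0.
    have -> : (i.+1 %% k = (i %% k).+1)%N.
      by rewrite {1}(divn_eq i k) -addnS modnMDl modn_small.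
    by rewrite addnS mulSn addnC leq_add2l.
  rewrite leq_eqVlt ltnS leqNgt ik orbF => /eqP ik1.
  have -> : (i.+1 %/ k = (i %/ k).+1)%N.
    by rewrite {1}(divn_eq i k) -addnS -ik1 divnMDl // divnn k0 addn1.
  have -> : (i.+1 %% k = 0)%N.
    by rewrite {1}(divn_eq i k) -addnS -ik1 modnMDl modnn.
  rewrite (leq_trans (leq_add IH (leqnn _))) // addn0 [in leqRHS]expnS.
  by move: (2 ^ _)%N (i %% k)%N ik1 => T r ->; nia.
rewrite /partition_degree -big_distrr /= big_ord_recr /=.
have := strong J; have := ltn_pmod J k0; rewrite expnS.
move: (\sum_(_ < _) _)%N (2 ^ _)%N (J %% k)%N => S T r rk; nia.
Qed.

End Partition.

(** * Signs of polynomials on connected components, and the conclusion *)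

Lemma mpoly_continuous (R : realType) d (p : {mpoly R[d]}) :
  continuous (fun x : 'rV[R]_d => peval p x).
Proof.
have cX (m : 'X_{1..d}) : continuous (fun x : 'rV[R]_d => \prod_i x ord0 i ^+ m i).
  elim: (index_enum _) => [|i r IH].
    rewrite (_ : (fun=> _) = fun=> 1); first exact: cst_continuous.
    by apply: boolp.funext => y; rewrite big_nil.
  rewrite (_ : (fun=> _) = (fun y : 'rV[R]_d => y ord0 i ^+ m i) \*
      (fun y => \prod_(j <- r) y ord0 j ^+ m j)); last first.
    by apply: boolp.funext => y; rewrite big_cons.
  move=> x; apply: continuousM; last exact: IH.
  apply: (@continuous_comp _ _ _ (fun y : 'rV[R]_d => y ord0 i) (fun u => u ^+ m i)).
    exact: coord_continuous.
  exact: exprn_continuous.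
have -> : (fun x => peval p x) =
    (fun x : 'rV[R]_d => \sum_(m <- msupp p) p@_m * \prod_i x ord0 i ^+ m i).
  by apply: boolp.funext => x; rewrite /peval mevalE.
elim: (msupp p : seq _) => [|m r IH].
  rewrite (_ : (fun=> _) = fun=> 0); first exact: cst_continuous.
  by apply: boolp.funext => y; rewrite big_nil.
rewrite (_ : (fun=> _) = (fun y : 'rV[R]_d => p@_m * \prod_i y ord0 i ^+ m i) +
    (fun y => \sum_(m <- r) p@_m * \prod_i y ord0 i ^+ m i)); last first.
  by apply: boolp.funext => y; rewrite big_cons.
move=> x; apply: continuousD; last exact: IH.
apply: (@continuousM _ _ (fun=> p@_m)); [exact: cst_continuous|exact: cX].
Qed.

Lemma connected_sign (R : realType) (T : topologicalType) (A : set T) (f : T -> R) x y :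
  connected A -> continuous f -> (forall z, A z -> f z <> 0) -> A x -> A y ->
  0 < f x -> 0 < f y.
Proof.
move=> Ac fc f0 Ax Ay fx; rewrite ltNge; apply/negP => fy.
have /connected_intervalP fI :=
  connected_continuous_connected Ac (continuous_subspaceT (A := A) fc).
have [|||z Az /(f0 z Az)//] := fI (f y) (f x) _ _ 0; [by exists y|by exists x|].
by rewrite fy ltW.
Qed.

Lemma pull_eval (K : fieldType) d n (s : 'I_n -> 'I_d) (p : {mpoly K[n]}) (x : 'rV[K]_d) :
  peval (pull s p) x = p.@[fun i => x ord0 (s i)].
Proof.
rewrite /peval /pull comp_mpoly_meval; apply: meval_eq => i.
by rewrite tnth_mktuple mevalXU.
Qed.

Theorem theorem4p2 (R : realType) (d D : nat) :
  exists C : R, 0 < C /\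
  forall (P : seq 'rV[R]_d) (V : set 'rV[R]_d) (d' : nat) (r : R),
    uniq P ->
    algebraic_variety V ->
    irreducible_variety V ->
    variety_dim V d' ->
    (1 <= d')%N ->
    variety_degree (complexification V) D ->
    1 < r -> r <= (size P)%:R ->
    exists g : mpoly.mpoly d R,
      partitioning_poly P r g /\
      ~ vanishing_ideal V g /\
      (pdeg g)%:R <= C * r `^ (d'%:R)^-1.
Proof.
(* [4 * d ^ 2] comes from [partition_degree_le] and k <= d; the successor keeps the constant
   positive for d = 0. *)
exists (4 * d ^ 2).+1%:R; split; first by rewrite ltr0n.
move=> P V k r _ _ _ [chain _] k0 _ r1 _.
have [s sV] := prime_chain_indep chain.
have kd : (k <= d)%N.
  have V0 : vanishing_ideal V 0 by move=> x _; rewrite /peval meval0.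
  by have := leq_card s (indep_inj V0 sV); rewrite !card_ord.
have r0 : 0 < r by exact: lt_trans r1.
have exJ : exists J, r <= 2 ^+ J.
  have [n rn] : exists n : nat, r <= n%:R.
    by exists (Num.truncn r).+1; rewrite ltW // truncnS_gt.
  by exists n; rewrite (le_trans rn) // -natrX ler_nat ltnW // ltn_expl.
(* Since r > 1 the least exponent is a successor [J.+1], the number of cuts, and 2^J < r <=
   2^(J+1). *)
case: (ex_minnP exJ) => -[|J] rJ Jmin; first by rewrite expr0 leNgt r1 in rJ.
have Jr : 2 ^+ J < r by rewrite ltNge; apply/negP => /Jmin; rewrite ltnn.
pose ev (x : 'rV[R]_d) (i : 'I_k) := x ord0 (s i).
have [gs [gs0 gsd gsJ gsP]] := cell_partition ev P J.+1 k0.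
pose g := \prod_(h <- gs) h.
have g0 : g != 0 by rewrite prodf_seq_neq0; apply/allP => h /(allP gs0).
exists (pull s g); split; [|split].
(* No factor of the polynomial vanishes on the component of [x], so each keeps its sign there and
   the component lies in the cell of the sign vector [b] of [x]. *)
- move=> x gx; pose b := [seq 0 < h.@[ev x] | h <- gs].
  have gE y : peval (pull s g) y = \prod_(h <- gs) peval (pull s h) y.
    rewrite pull_eval /g rmorph_prod; apply: eq_bigr => h _.
    by rewrite pull_eval.
  have h0 h y : h \in gs -> ~ zero_set (pull s g) y -> peval (pull s h) y != 0.
    move=> hgs gy; apply/eqP => hy; apply: gy; rewrite /zero_set /= gE.
    by rewrite (big_rem h hgs) /= hy mul0r.
  pose A := connected_component (~` zero_set (pull s g)) x.
  have Anz z : A z -> ~ zero_set (pull s g) z by move=> /connected_component_sub.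
  have Ax : A x by exact: connected_component_refl.
  have cellP y : A y -> cell ev gs b y.
    move=> Ay; rewrite /cell /b.
    have {gs0 gsd gsJ gsP} : {in gs, forall h,
        if 0 < h.@[ev x] then 0 < h.@[ev y] else h.@[ev y] < 0}.
      move=> h hgs.
      have sgn u v : A u -> A v -> 0 < h.@[ev u] -> 0 < h.@[ev v].
        rewrite -!pull_eval => Au Av; apply: (connected_sign _ _ _ Au Av).
        - exact: component_connected.
        - exact: mpoly_continuous.
        - by move=> z /Anz /(h0 h z hgs)/eqP.
      case: ifPn => [|hx]; first exact: sgn.
      have := h0 h y hgs (Anz y Ay); rewrite pull_eval -[_.@[_]]/(h.@[ev y]).
      by case: ltgtP => // /(sgn y x Ay Ax); rewrite (negbTE hx).
    elim: (gs) => //= h hs IH hP; rewrite hP ?inE ?eqxx //= IH // => u us.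
    by apply: hP; rewrite inE us orbT.
  have nb : size b = J.+1 by rewrite size_map.
  have le1 : (count (fun p => p \in A) P * 2 ^ J.+1 <= size P)%N.
    apply: leq_trans (gsP b nb); rewrite leq_mul2r; apply/orP; right.
    by apply: sub_count => y /set_mem /cellP.
  rewrite ler_pdivlMr //.
  apply: (le_trans (y := (count (fun p => p \in A) P)%:R * 2 ^+ J.+1)).
    by rewrite ler_wpM2l.
  by rewrite -natrX -natrM ler_nat.
- by move=> /sV /eqP; rewrite (negbTE g0).
(* The k-th power of the left side is at most 2^J, which is below r. *)
have q2 : 2 ^+ (J %/ k) <= r `^ (k%:R)^-1.
  have -> : (2 ^+ (J %/ k) : R) = ((2 ^+ (J %/ k)) ^+ k) `^ (k%:R)^-1.
    rewrite -[X in X `^ _]powR_mulrn ?exprn_ge0 // -powRrM mulfV ?pnatr_eq0 -?lt0n //.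
    by rewrite powRr1 ?exprn_ge0.
  apply: ge0_ler_powR; rewrite ?nnegrE ?invr_ge0 ?exprn_ge0 ?(ltW r0) //.
  rewrite -exprM (le_trans _ (ltW Jr)) // ler_weXn2l ?ler1n //.
  exact: leq_trunc_div.
have gd : (pdeg (pull s g) <= 4 * d ^ 2 * 2 ^ (J %/ k))%N.
  rewrite (leq_trans (pdeg_pull_le _ _)) // (leq_trans (pdeg_prod_le _ _ _)) //.
  rewrite (leq_trans gsd) // (leq_trans (partition_degree_le J k0)) //.
  by rewrite leq_mul2r leq_mul2l leq_sqr kd !orbT.
apply: (le_trans (y := (4 * d ^ 2)%:R * 2 ^+ (J %/ k))).
  by rewrite -natrX -natrM ler_nat.
by rewrite ler_pM ?exprn_ge0 // ler_nat.
Qed.
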